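(* Let $L, M, N \ge 1$ be integers and let $\mathbf{A} = (a_{ij})_{1\le i\le M,\,1\le j\le N}$ be an $M\times N$ matrix of filters $a_{ij}\in\mathbb{C}^L$. Let $\sigma_0,\dots,\sigma_{L-1}$ be permutations of $\{1,\dots,N\}$ and let $\tilde{\mathbf{A}}=(\tilde a_{ij})$ be the matrix of filters defined in the frequency domain by $(\mathbf{F}\tilde a_{ij})[\omega] = (\mathbf{F} a_{i\sigma_\omega(j)})[\omega]$ for all $0\le\omega<L$ and all $i,j$. Let $\Gamma_{ij}\subset\{0,\dots,L-1\}$ denote the support of $a_{ij}$ and suppose that for every $i$ and every $j_1\neq j_2$, $\Gamma_{i,j_1}\cap\Gamma_{i,j_2}=\emptyset$. Then for every $0\le p\le 1$, $\|\tilde{\mathbf{A}}\|_p \ge \|\mathbf{A}\|_p$.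
   Context: A filter is a vector $u=(u[t])_{0\le t<L}\in\mathbb{C}^L$; $\mathbf{F}$ denotes the discrete Fourier transform on $\mathbb{C}^L$, $(\mathbf{F}u)[\omega]=\sum_{t=0}^{L-1}u[t]e^{-2i\pi\omega t/L}$ (up to normalization). For $0<p\le 1$, $\|\mathbf{A}\|_p^p := \sum_{i,j,t}|a_{ij}[t]|^p$; for $p=0$, $\|\mathbf{A}\|_0 := \sum_{i,j}\|a_{ij}\|_0$ where $\|u\|_0=\#\{t: u[t]\neq 0\}$. *)

(* Defs.v *)
From mathcomp Require Import all_boot all_order all_algebra all_fingroup.
From mathcomp Require Import complex.
From mathcomp Require Import reals exp trigo.

Set Implicit Arguments.
Unset Strict Implicit.
Unset Printing Implicit Defensive.

Import Order.TTheory GRing.Theory Num.Theory.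

Local Open Scope ring_scope.
Local Open Scope complex_scope.

Notation cfilter R L := {ffun 'I_L -> R[i]}.

(* e^(i theta), by Euler's formula: the library has no complex exponential. *)
Definition expi (R : realType) (theta : R) : R[i] := cos theta +i* sin theta.

Definition dft (R : realType) (L : nat) (u : cfilter R L) : cfilter R L :=
  [ffun w : 'I_L =>
     \sum_(t < L) u t * expi (- (2 * pi * w%:R * t%:R / L%:R))].

Definition lpsum (R : realType) (L M N : nat) (p : R)
    (A : 'M[cfilter R L]_(M, N)) : R :=
  \sum_(i < M) \sum_(j < N) \sum_(t < L) Normc.normc (A i j t) `^ p.

Definition l0norm (R : realType) (L M N : nat) (A : 'M[cfilter R L]_(M, N)) :
    nat :=
  (\sum_(i < M) \sum_(j < N) #|support (A i j)|)%N.

(* The case p = 0 is separate because 0 `^ 0 = 1. *)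
Definition lpnorm (R : realType) (L M N : nat) (p : R)
    (A : 'M[cfilter R L]_(M, N)) : R :=
  if p == 0 then (l0norm A)%:R else lpsum p A `^ p^-1.

(* Main.v *)
Require Import Defs.
From mathcomp Require Import all_boot all_order all_algebra all_fingroup.
From mathcomp Require Import complex.
From mathcomp Require Import reals exp trigo.
From mathcomp Require Import ring lra.

(* Row by row: permuting the filters at each frequency does not change their
   sum over j in the frequency domain, hence, the Fourier transform being
   injective, it does not change the sum in the time domain either.  Disjoint
   supports make a filter row of A cost exactly as much as its sum, while any
   row costs at least as much as its sum, because both |z|^p (0 < p <= 1) and
   the indicator of z <> 0 are subadditive. *)

Import Order.TTheory GRing.Theory Num.Theory.

Local Open Scope ring_scope.
Local Open Scope complex_scope.

Lemma powRD_le (R : realType) (x y p : R) :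
  0 <= x -> 0 <= y -> p <= 1 -> (x + y) `^ p <= x `^ p + y `^ p.
Proof.
move=> x0 y0 p1.
have [s0|s0] := eqVneq (x + y) 0.
  have -> : x = 0 by lra.
  have -> : y = 0 by lra.
  by rewrite addr0 lerDl powR_ge0.
have spos : 0 < x + y by rewrite lt0r s0 addr_ge0.
(* Normalize to x + y = 1, where t <= t^p for t = x and t = y. *)
have scaled z : 0 <= z -> z <= x + y ->
    z / (x + y) * (x + y) `^ p <= z `^ p.
  move=> z0 zs; have [->|zn0] := eqVneq z 0; first by rewrite !mul0r powR_ge0.
  have q0 : 0 < z / (x + y) by rewrite divr_gt0 // lt0r zn0.
  have q1 : z / (x + y) <= 1 by rewrite ler_pdivrMr // mul1r.
  rewrite -[in leRHS](divfK s0 z) powRM ?(ltW q0) ?(ltW spos) //.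
  by rewrite ler_wpM2r ?powR_ge0 // ger1_powR // q0.
have := lerD (scaled x x0 _) (scaled y y0 _).
rewrite -mulrDl -mulrDl divff // mul1r; apply; lra.
Qed.

(** By the half-angle formula, [cos x = 1] would force [sin (x / 2) = 0], but [x / 2] lies strictly
    between 0 and [pi]. *)
Lemma cos_neq1 (R : realType) (x : R) : 0 < x < 2 * pi -> cos x != 1.
Proof.
move=> /andP[x0 x2pi]; apply/eqP => cx1.
have sx : 0 < sin (x / 2) by apply: sin_gt0_pi; apply/andP; split; lra.
have := cos2Dsin2 (x / 2).
have : cos (x / 2 *+ 2) = 1 by rewrite -mulr_natr divfK // pnatr_eq0.
rewrite cos_mulr2n; nra.
Qed.

(** Equal values would turn the subtraction formula for [cos (x - y)] into [cos2Dsin2], making it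
    1. *)
Lemma expi_neq (R : realType) (x y : R) :
  0 < x - y < 2 * pi -> expi x != expi y.
Proof.
move=> hxy; apply/eqP => -[cxy sxy].
have /eqP[] := cos_neq1 _ _ hxy.
by rewrite cosB cxy sxy -!expr2 cos2Dsin2.
Qed.

Lemma expiMn (R : realType) (x : R) (n : nat) : expi (x * n%:R) = expi x ^+ n.
Proof.
elim: n => [|n IHn]; first by rewrite mulr0 expr0 /expi cos0 sin0.
rewrite exprSr -IHn -natr1 mulrDr mulr1 /expi cosD sinD.
by congr (_ +i* _); ring.
Qed.

Lemma dft_sum (R : realType) (L : nat) (I : finType) (u : I -> cfilter R L) :
  dft (\sum_i u i) = \sum_i dft (u i).
Proof.
apply/ffunP => w; rewrite sum_ffunE ffunE.
under [RHS]eq_bigr do rewrite ffunE.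
rewrite exchange_big; apply: eq_bigr => t _.
by rewrite sum_ffunE mulr_suml.
Qed.

Lemma dftB (R : realType) (L : nat) (u v : cfilter R L) :
  dft (u - v) = dft u - dft v.
Proof.
apply/ffunP => w; rewrite !ffunE -sumrB; apply: eq_bigr => t _.
by rewrite !ffunE mulrBl.
Qed.

(* [dft u] lists the values at the L distinct L-th roots of unity of the
   polynomial with coefficients [u], whose degree is less than L. *)
Lemma dft_eq0 (R : realType) (L : nat) (u : cfilter R L) : dft u = 0 -> u = 0.
Proof.
case: L u => [|L] u u0; first by apply/ffunP => -[].
pose q : {poly R[i]} := \poly_(k < L.+1) u (inord k).
pose node (w : 'I_L.+1) : R[i] := expi (- (2 * pi * w%:R / L.+1%:R)).
have q_node w : q.[node w] = dft u w.
  rewrite horner_poly ffunE; apply: eq_bigr => t _.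
  by rewrite inord_val -expiMn; congr (_ * expi _); ring.
(* Ordering [v < w] places the angle difference, taken as [v] minus [w] because of the minus sign in
   [node], strictly between 0 and [2 * pi]. *)
have node_neq (v w : 'I_L.+1) : (v < w)%N -> node v != node w.
  move=> vw; apply: expi_neq.
  have -> : - (2 * pi * v%:R / L.+1%:R) - - (2 * pi * w%:R / L.+1%:R)
      = 2 * pi * ((w - v)%:R / L.+1%:R) :> R.
    by rewrite natrB ?(ltnW vw) //; ring.
  have pi2 : 0 < 2 * pi :> R by rewrite mulr_gt0 ?pi_gt0.
  rewrite mulr_gt0 ?divr_gt0 ?ltr0n ?subn_gt0 //=.
  rewrite gtr_pMr // ltr_pdivrMr ?ltr0n // mul1r ltr_nat.
  exact: leq_ltn_trans (leq_subr _ _) (ltn_ord w).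
have node_inj : injective node.
  move=> v w /eqP; apply: contraTeq; rewrite neq_ltn => /orP[|] /node_neq //.
  by rewrite eq_sym.
have q0 : q = 0.
  (* A nonzero [q] has fewer distinct roots than its size, which is at most [L.+1], whereas all
     [L.+1] nodes are roots. *)
  apply/eqP; apply: contraT => qn0.
  have /(max_poly_roots qn0) : all (root q) (codom node).
    by apply/allP => _ /codomP[w ->]; rewrite /root q_node u0 ffunE.
  rewrite map_inj_uniq ?enum_uniq // => /(_ isT).
  by rewrite size_codom card_ord ltnNge size_poly.
apply/ffunP => t; have := congr1 (fun r : {poly R[i]} => r`_t) q0.
by rewrite coef_poly ltn_ord inord_val coef0 ffunE.
Qed.

Lemma dft_inj (R : realType) (L : nat) : injective (@dft R L).
Proof.
by move=> u v uv; apply/eqP; rewrite -subr_eq0; apply/eqP/dft_eq0;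
  rewrite dftB uv subrr.
Qed.

Lemma sum_dft_perm (R : realType) (L N : nat) (a b : 'I_N -> cfilter R L)
    (sigma : 'I_L -> 'S_N) :
  (forall w j, dft (b j) w = dft (a (sigma w j)) w) ->
  \sum_j b j = \sum_j a j.
Proof.
move=> hb; apply: dft_inj; apply/ffunP => w.
rewrite !dft_sum !sum_ffunE [RHS](reindex_inj (@perm_inj _ (sigma w))).
by apply: eq_bigr => j _; rewrite hb.
Qed.

(** The cost [f] is kept abstract to cover both the power of the modulus and the indicator of
    nonzero values. The comparison holds at each [t] separately, through the cost of the common
    sum. *)
Lemma subadditive_disjoint_sum_le (V : zmodType) (R : numDomainType)
    (f : V -> R) (I T : finType) (a b : I -> {ffun T -> V}) :
  f 0 = 0 -> (forall x y, f (x + y) <= f x + f y) ->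
  (forall i j, i <> j -> [disjoint support (a i) & support (a j)]) ->
  \sum_i b i = \sum_i a i ->
  \sum_i \sum_t f (a i t) <= \sum_i \sum_t f (b i t).
Proof.
move=> f0 fD adisj ab; rewrite exchange_big [leRHS]exchange_big.
apply: ler_sum => t _.
have -> : \sum_i f (a i t) = f (\sum_i b i t).
  rewrite -sum_ffunE ab sum_ffunE.
  (* By disjointness at most one term is nonzero at [t], so [f] commutes with this sum. *)
  case: (pickP (fun i => a i t != 0)) => [i ait|a0].
    have aj0 j : j != i -> a j t = 0.
      move=> /eqP ji; apply/eqP; apply: contraT => ajt.
      by have /pred0P/(_ t) := adisj _ _ ji; rewrite /= !inE ajt ait.
    rewrite (bigD1 i) //= [X in _ = f X](bigD1 i) //=.
    by rewrite !big1 ?addr0 // => j /aj0 ->.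
  have {}a0 i : a i t = 0 by apply/eqP; move/(_ i)/negbFE: a0.
  by rewrite !big1 // => i _; rewrite a0.
elim/big_ind2: _ => // [|x r y s xr ys]; first by rewrite f0.
exact: le_trans (fD _ _) (lerD xr ys).
Qed.

Theorem theorem1 (R : realType) (L M N : nat)
  (hL : (1 <= L)%N) (hM : (1 <= M)%N) (hN : (1 <= N)%N)
  (A At : 'M[cfilter R L]_(M, N)) (sigma : 'I_L -> 'S_N)
  (hAt : forall (w : 'I_L) (i : 'I_M) (j : 'I_N),
      dft (At i j) w = dft (A i (sigma w j)) w)
  (hdisj : forall (i : 'I_M) (j1 j2 : 'I_N), j1 <> j2 ->
      [disjoint support (A i j1) & support (A i j2)])
  (p : R) (hp0 : 0 <= p) (hp1 : p <= 1) :
  lpnorm p A <= lpnorm p At.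
Proof.
have cost_le (f : R[i] -> R) : f 0 = 0 -> (forall x y, f (x + y) <= f x + f y) ->
    \sum_i \sum_j \sum_t f (A i j t) <= \sum_i \sum_j \sum_t f (At i j t).
  move=> f0 fD; apply: ler_sum => i _.
  apply: subadditive_disjoint_sum_le => //; first exact: hdisj.
  by apply: sum_dft_perm => w j; exact: hAt.
rewrite /lpnorm; have [_|pn0] := eqVneq p 0.
  have l0normE (B : 'M[cfilter R L]_(M, N)) :
      (l0norm B)%:R = \sum_i \sum_j \sum_t (B i j t != 0)%:R :> R.
    rewrite natr_sum; apply: eq_bigr => i _.
    rewrite natr_sum; apply: eq_bigr => j _.
    rewrite -sum1_card big_mkcond natr_sum.
    by apply: eq_bigr => t _; rewrite inE; case: eqP.
  rewrite !l0normE; apply: (cost_le (fun z => (z != 0)%:R)) => [|x y].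
    by rewrite eqxx.
  (* If [x] is nonzero, the right side is already at least 1, which bounds any indicator. *)
  have [->|_] := eqVneq x 0; first by rewrite add0r add0r.
  by rewrite -natrD ler_nat (leq_trans (leq_b1 _)).
have lpsum_ge0 (B : 'M[cfilter R L]_(M, N)) : 0 <= lpsum p B.
  by do 3 (apply: sumr_ge0 => ? _); exact: powR_ge0.
(* The outer power [p^-1] is monotone on nonnegative reals, so comparing the [lpsum] values
   suffices. *)
apply: ge0_ler_powR; rewrite ?nnegrE ?invr_ge0 ?lpsum_ge0 //.
apply: (cost_le (fun z => Normc.normc z `^ p)) => [|x y].
  by rewrite Normc.normc0 powR0.
have normc_ge0 (z : R[i]) : 0 <= Normc.normc z by case: z => *; exact: sqrtr_ge0.
(* The triangle inequality under the monotone power [p] comes first, then subadditivity of that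
   power. *)
apply: le_trans (powRD_le _ _ _ _ (normc_ge0 x) (normc_ge0 y) hp1).
by apply: ge0_ler_powR; rewrite ?nnegrE ?addr_ge0 ?normc_ge0 // le_normcD.
Qed.
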